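(* Let $f:[0,\infty)\to\mathbb{R}$ be a monotone concave function with $f(0)\ge 0$, and let $A,B$ be $n\times n$ complex positive semidefinite matrices. Then there exist $n\times n$ unitary matrices $U$ and $V$ such that $$ f(A+B)\le U f(A) U^* + V f(B) V^* . $$
   Context: For a Hermitian matrix $H$ with spectrum in the domain of a real function $f$, $f(H)$ is defined by the spectral functional calculus. For Hermitian matrices, $X\le Y$ means that $Y-X$ is positive semidefinite. Positive semidefinite matrices are in particular Hermitian. Monotone means either nondecreasing or nonincreasing. *)

(* Defs.v *)
From mathcomp Require Export all_boot all_order all_algebra.
From mathcomp Require Export interval_inference classical_sets set_interval.
From mathcomp Require Export reals convex complex.

Set Implicit Arguments.
Unset Strict Implicit.
Unset Printing Implicit Defensive.

Import Order.TTheory GRing.Theory Num.Theory.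
Local Open Scope ring_scope.
Local Open Scope complex_scope.
Local Open Scope convex_scope.
Local Open Scope sesquilinear_scope.

Definition concave_function (R : realType)
    (D : set (convex_lmodType R^o)) (f : convex_lmodType R^o -> R^o) : Prop :=
  forall t : {i01 R}, {in D &, forall x y : convex_lmodType R^o,
    f x <| t |> f y <= f (x <| t |> y)}.

Definition monotone_function (R : realType) (D : interval R) (f : R -> R) :
    Prop :=
  {in D &, {homo f : x y / x <= y}} \/ {in D &, {homo f : x y /~ x <= y}}.

(* The order on [R[i]] makes [0 <= z] mean that [z] is real and nonnegative. *)
Definition psdmx (R : realType) (n : nat) (A : 'M[R[i]]_n) : Prop :=
  A \is hermsymmx /\ forall x : 'cV[R[i]]_n, 0 <= (x^t* *m A *m x) 0 0.

Definition loewner_le (R : realType) (n : nat) (X Y : 'M[R[i]]_n) : Prop :=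
  psdmx (Y - X).

(* For normal [H], the library diagonalizes
   [H = (spectralmx H)^t* *m diag_mx (spectral_diag H) *m spectralmx H].
   When [H] is Hermitian the eigenvalues are real, so that [complex.Re] loses
   nothing; by [mxfunE] the result does not depend on the diagonalization. *)
Definition mxfun (R : realType) (n : nat) (f : R -> R) (H : 'M[R[i]]_n) :
    'M[R[i]]_n :=
  (spectralmx H)^t* *m
    diag_mx (map_mx (fun z : R[i] => (f (complex.Re z))%:C) (spectral_diag H))
  *m spectralmx H.

Lemma mxfunE (R : realType) (n : nat) (f : R -> R) (Q : 'M[R[i]]_n)
    (d : 'rV[R]_n) : Q \is unitarymx ->
  mxfun f (Q^t* *m diag_mx (map_mx (real_complex R) d) *m Q) =
  Q^t* *m diag_mx (map_mx (fun x => (f x)%:C) d) *m Q.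
Proof.
move=> Qu; set H := (X in mxfun f X).
have QQ : Q *m Q^t* = 1%:M by apply/unitarymxP.
have QQ' : Q^t* *m Q = 1%:M by exact: mulmx1C.
have Hn : H \is normalmx.
  apply: hermitian_normalmx; apply/is_hermitianmxP.
  rewrite expr0 scale1r /H !trmx_mul !map_mxM /= tr_diag_mx trmxCK mulmxA.
  congr (_ *m _ *m _); apply/matrixP => i j; rewrite !mxE rmorphMn /=.
  by congr (_ *+ _); apply/esym; exact: conjc_real.
have /orthomx_spectralP HE := Hn.
rewrite /mxfun; set P := spectralmx H; set e := spectral_diag H.
have Pu : P \is unitarymx by exact: spectral_unitarymx.
have PP : P *m P^t* = 1%:M by apply/unitarymxP.
have PP' : P^t* *m P = 1%:M by exact: mulmx1C.
pose W := P *m Q^t*.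
have eW : diag_mx e *m W = W *m diag_mx (map_mx (real_complex R) d).
  have : P *m H *m Q^t* = P *m H *m Q^t* by [].
  rewrite {1}HE {1}/H (invmx_unitary Pu) -/P -/e !mulmxA PP mul1mx => ->.
  by rewrite -!mulmxA QQ mulmx1.
set fe := map_mx _ e; set fd := map_mx _ d.
have few : diag_mx fe *m W = W *m diag_mx fd.
  apply/matrixP => i j; move/matrixP/(_ i j): eW; rewrite {}/fe {}/fd.
  move: W => W; rewrite !mul_diag_mx !mul_mx_diag !mxE mulrC.
  have [->|W0] := eqVneq (W i j) 0; first by rewrite !(mulr0, mul0r).
  by move=> /(mulfI W0) ->; rewrite mulrC.
  have -> : P^t* *m diag_mx fe *m P = P^t* *m (diag_mx fe *m W) *m Q.
  by rewrite /W -!mulmxA QQ' mulmx1.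
by rewrite few /W !mulmxA PP' mul1mx.
Qed.

(* Main.v *)
(* Subtracting f(0), assume f(0) = 0; then f has constant sign.  Put H = A + B,
   let K be the pseudo-inverse of H^(1/2) and X = A^(1/2) K, Y = B^(1/2) K.  Then
   X H X^* = A, Y H Y^* = B, and X^* X + Y^* Y is the projection onto the range
   of H, so with G = |f|(H)^(1/2) the matrix f(H) is the sum of
   +-G X^* X G and +-G Y^* Y G.  As T^* T and T T^* are unitarily similar, the
   first term is unitarily similar to X f(H) X^*.  Since X is a contraction,
   Jensen's inequality bounds the quadratic form of X f(H) X^* by f of the
   quadratic form of X H X^* = A, and a comparison of eigenvalue counts
   turns this into X f(H) X^* <= U f(A) U^* for some unitary U. *)
Require Import Defs.
From mathcomp Require Import all_boot all_order all_algebra all_fingroup.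
From mathcomp Require Import interval_inference classical_sets set_interval.
From mathcomp Require Import reals convex complex.
From mathcomp Require Import ring lra.

Set Implicit Arguments.
Unset Strict Implicit.
Unset Printing Implicit Defensive.

Import Order.TTheory GRing.Theory Num.Theory.
Local Open Scope ring_scope.
Local Open Scope complex_scope.
Local Open Scope sesquilinear_scope.

(** * Counting, linear equations and scalar concavity *)

(** Counts above every threshold replace sorting. The threshold [a i0], the maximum of [a], shows
    that the maximum of [b] is at least as large; these two indices are matched and the others are
    handled by induction. *)
Lemma perm_of_count (R : realType) n (a b : 'I_n -> R) :
  (forall c : R, (#|[pred i | c <= a i]%R| <= #|[pred i | c <= b i]%R|)%N) ->
  exists s : 'S_n, forall i, a i <= b (s i).
Proof.
elim: n a b => [|n IHn] a b ab; first by exists 1%g => -[].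
have [i0 _ ai0] := arg_maxP a (isT : xpredT (ord0 : 'I_n.+1)).
have [j0 _ bj0] := arg_maxP b (isT : xpredT (ord0 : 'I_n.+1)).
have abij : a i0 <= b j0.
  have /card_gt0P[j] : (0 < #|[pred i | a i0 <= b i]%R|)%N.
    apply: leq_trans (ab (a i0)); apply/card_gt0P; exists i0.
    by rewrite inE.
  by rewrite inE => /le_trans; apply; exact: bj0.
have cardL (u : 'I_n.+1 -> R) k c :
    #|[pred i | c <= u i]%R| =
      ((c <= u k)%R + #|[pred i | (c <= u (lift k i))%R]|)%N.
  rewrite -!sum1_card big_mkcond (bigD1_ord k) //= -big_mkcond /=.
  by rewrite inE; case: ifP.
have [c|s sP] := IHn (a \o lift i0) (b \o lift j0).
  (* For [c <= a i0] both counts lose exactly one; above [a i0] the left count is zero. *)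
  have [ca|ca] := leP c (a i0).
    have := ab c; rewrite (cardL a i0) (cardL b j0) ca.
    by rewrite (le_trans ca abij) leq_add2l.
  have /eq_card0-> // : [pred i | c <= (a \o lift i0) i]%R =i pred0.
  move=> i; rewrite !inE; apply/negbTE.
  by rewrite -ltNge (le_lt_trans _ ca) //; exact: ai0.
exists (lift_perm i0 j0 s) => i.
case: (unliftP i0 i) => [k|] ->; last by rewrite lift_perm_id.
by rewrite lift_perm_lift; exact: sP.
Qed.

(** Fewer than [n] homogeneous linear equations in [n] unknowns have a nonzero solution. *)
Lemma mulmx_nontrivial_zeros (F : fieldType) n (K L : 'M[F]_n)
    (I J : pred 'I_n) :
  (#|I| + #|J| < n)%N ->
  exists2 x : 'cV[F]_n, x != 0 &
    (forall i, I i -> (K *m x) i 0 = 0) /\ (forall j, J j -> (L *m x) j 0 = 0).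
Proof.
move=> IJ.
(* The equations are the columns of [M], so the transpose of a row in its left kernel solves
   them. *)
pose M : 'M_(n, #|I| + #|J|) :=
  row_mx (colsub (@enum_val _ I) K^T) (colsub (@enum_val _ J) L^T).
have Mn0 : kermx M != 0.
  rewrite kermx_eq0 /row_free neq_ltn.
  by rewrite (leq_ltn_trans (rank_leq_col _) IJ).
pose u := nz_row (kermx M).
have /sub_kermxP : (u <= kermx M)%MS by exact: nz_row_sub.
rewrite mul_mx_row -[0]row_mx0 => /eq_row_mx[uI uJ].
exists u^T; first by rewrite trmx_eq0 nz_row_eq0.
have zero (P : pred 'I_n) (N : 'M_n) :
    u *m colsub (@enum_val _ P) N^T = 0 -> forall i, P i -> (N *m u^T) i 0 = 0.
  move=> /matrixP uN i Pi; have := uN 0 (enum_rank_in Pi i).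
  rewrite mulmx_colsub !mxE enum_rankK_in // => uNi.
  by rewrite -[RHS]uNi; apply: eq_bigr => k _; rewrite !mxE mulrC.
by split; exact: zero.
Qed.

(** The missing mass sits at 0, where [f] is nonnegative; this is the base case. The induction
    splits off one point and divides the other weights by [1 - w i], which keeps their sum at most
    1. *)
Lemma subprobability_jensen (R : realType) (f : R -> R) (I : eqType) (r : seq I)
    (w h : I -> R) :
  concave_function `[0, +oo[%classic f -> 0 <= f 0 ->
  (forall i, 0 <= w i) -> (forall i, 0 <= h i) -> \sum_(i <- r) w i <= 1 ->
  \sum_(i <- r) w i * f (h i) <= f (\sum_(i <- r) w i * h i).
Proof.
move=> fc f0 w0 h0.
have fc2 t x y : 0 <= t -> t <= 1 -> 0 <= x -> 0 <= y ->
    t * f x + (1 - t) * f y <= f (t * x + (1 - t) * y).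
  move=> t0 t1 x0 y0; have := fc (Itv01 t0 t1) x y.
  rewrite !convRE /=; apply; apply/mem_set; by rewrite /= in_itv /= ?x0 ?y0.
elim: r w w0 => [|i r IHr] w w0; first by rewrite !big_nil.
rewrite !big_cons => w1.
have wr0 : 0 <= \sum_(j <- r) w j by exact: sumr_ge0.
(* The division by [1 - w i] excludes [w i = 1]; in that case the other weights vanish. *)
have [wi1|wi1] := eqVneq (w i) 1.
  have wr j : j \in r -> w j = 0.
    have : \sum_(j <- r) w j == 0 by apply/eqP; lra.
    by rewrite psumr_eq0 // => /allP W /W /eqP.
  rewrite wi1 !mul1r.
  by do 2![rewrite big_seq big1 => [|j /wr->]; rewrite ?mul0r // addr0].
have ti : 0 < 1 - w i by rewrite subr_gt0 lt_neqAle wi1 /=; lra.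
have wsub : \sum_(j <- r) w j / (1 - w i) <= 1.
  by rewrite -mulr_suml ler_pdivrMr //; lra.
have := IHr (fun j => w j / (1 - w i)) _ wsub.
have E (g : I -> R) : \sum_(j <- r) w j * g j =
    (1 - w i) * \sum_(j <- r) w j / (1 - w i) * g j.
  rewrite mulr_sumr; apply: eq_bigr => j _; field.
  by rewrite gt_eqF.
move=> IH; rewrite (E h) (E (f \o h)) /=.
have w'0 j : 0 <= w j / (1 - w i) by rewrite divr_ge0 // ltW.
apply: le_trans (fc2 _ _ _ _ _ _ _) => //.
- by rewrite lerD2l ler_wpM2l ?IH ?ltW.
- lra.
- by apply: sumr_ge0 => j _; rewrite mulr_ge0.
Qed.

(** An average lies between the extreme values of [h] on the support of [w]; the largest one serves
    a nondecreasing [f], the smallest one a nonincreasing [f]. *)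
Lemma monotone_average_le (R : realType) (f : R -> R) (I : finType)
    (w h : I -> R) :
  monotone_function `[0, +oo[ f ->
  (forall i, 0 <= w i) -> (forall i, 0 <= h i) -> \sum_i w i = 1 ->
  exists2 i, w i != 0 & f (\sum_i w i * h i) <= f (h i).
Proof.
move=> fm w0 h0 w1.
have [i wi] : exists i, w i != 0.
  apply/existsP; apply: contraT; rewrite negb_exists => /forallP W.
  move: w1; rewrite big1 => [/eqP|j _]; first by rewrite eq_sym oner_eq0.
  by apply/eqP; have := W j; rewrite negbK.
set H := \sum_i w i * h i.
have H0 : 0 <= H by apply: sumr_ge0 => j _; rewrite mulr_ge0.
have in0 x : 0 <= x -> x \in `[0, +oo[ by rewrite in_itv /= andbT.
case: fm => fm.
  have [j wj hj] := arg_maxP h (wi : [pred i | w i != 0] i).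
  exists j => //; apply: fm; rewrite ?in0 //.
  have -> : h j = \sum_i w i * h j by rewrite -mulr_suml w1 mul1r.
  apply: ler_sum => k _.
  have [->|wk] := eqVneq (w k) 0; first by rewrite !mul0r.
  by rewrite ler_wpM2l //; exact: hj.
have [j wj hj] := arg_minP h (wi : [pred i | w i != 0] i).
exists j => //; apply: fm; rewrite ?in0 //.
have -> : h j = \sum_i w i * h j by rewrite -mulr_suml w1 mul1r.
apply: ler_sum => k _.
have [->|wk] := eqVneq (w k) 0; first by rewrite !mul0r.
by rewrite ler_wpM2l //; exact: hj.
Qed.

(** * Adjoints and real-valued quadratic forms *)

Section Forms.
Variable R : realType.
Local Notation C := R[i].

Definition adjmx m n (M : 'M[C]_(m, n)) : 'M[C]_(n, m) := M^t*.
Local Notation "M ^H" := (adjmx M) (at level 2, format "M ^H").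

Lemma adjmxM m n p (A : 'M[C]_(m, n)) (B : 'M[C]_(n, p)) :
  (A *m B)^H = B^H *m A^H.
Proof. by rewrite /adjmx trmx_mul map_mxM. Qed.

Lemma adjmxK m n (A : 'M[C]_(m, n)) : A^H^H = A.
Proof. exact: trmxCK. Qed.

Lemma adjmxD m n (A B : 'M[C]_(m, n)) : (A + B)^H = A^H + B^H.
Proof. by rewrite /adjmx linearD map_mxD. Qed.

Lemma adjmxB m n (A B : 'M[C]_(m, n)) : (A - B)^H = A^H - B^H.
Proof. by rewrite /adjmx linearB map_mxB. Qed.

Lemma hermsymmxE n (A : 'M[C]_n) : A \is hermsymmx -> A^H = A.
Proof. by move=> /is_hermitianmxP; rewrite expr0 scale1r => /esym. Qed.

Lemma unitary_mulmxV n (U : 'M[C]_n) : U \is unitarymx -> U *m U^H = 1%:M.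
Proof. by move/unitarymxP. Qed.

Lemma unitary_mulVmx n (U : 'M[C]_n) : U \is unitarymx -> U^H *m U = 1%:M.
Proof. by move/unitarymxP/mulmx1C. Qed.

Lemma adjmx_unitary n (U : 'M[C]_n) : U \is unitarymx -> U^H \is unitarymx.
Proof. by rewrite trmxC_unitary. Qed.

(** The squared modulus with values in [R]; the norm on [R[i]] takes its values in [R[i]]. *)
Definition sqmod (z : C) : R := complex.Re z ^+ 2 + complex.Im z ^+ 2.

Lemma sqmod_ge0 z : 0 <= sqmod z.
Proof. by rewrite addr_ge0 ?sqr_ge0. Qed.

Lemma sqmodE z : Num.conj z * z = (sqmod z)%:C.
Proof. by rewrite /sqmod add_Re2_Im2 sqr_normc mulrC. Qed.

Lemma sqmod0 : sqmod 0 = 0.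
Proof. by rewrite /sqmod expr0n addr0. Qed.

Lemma sqmod_eq0 z : (sqmod z == 0) = (z == 0).
Proof.
by case: z => u v; rewrite paddr_eq0 ?sqr_ge0 // !sqrf_eq0 complex.eq_complex.
Qed.

Definition qform n (M : 'M[C]_n) (x : 'cV[C]_n) : R :=
  complex.Re ((x^H *m M *m x) 0 0).

Definition sqnorm n (x : 'cV[C]_n) : R := \sum_i sqmod (x i 0).

Lemma sqnorm_ge0 n (x : 'cV[C]_n) : 0 <= sqnorm x.
Proof. by apply: sumr_ge0 => i _; exact: sqmod_ge0. Qed.

Lemma sqnorm_eq0 n (x : 'cV[C]_n) : (sqnorm x == 0) = (x == 0).
Proof.
rewrite psumr_eq0 => [|i _]; last exact: sqmod_ge0.
apply/allP/eqP => [x0|-> i _]; last by rewrite mxE sqmod0 eqxx.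
apply/matrixP => i j; rewrite ord1 mxE; apply/eqP; rewrite -sqmod_eq0.
by apply: x0; rewrite mem_index_enum.
Qed.

Lemma sqnormZ n (x : 'cV[C]_n) (a : R) : sqnorm (a%:C *: x) = a ^+ 2 * sqnorm x.
Proof.
rewrite /sqnorm mulr_sumr; apply: eq_bigr => i _; rewrite mxE.
by case: (x i 0) => u v; rewrite /sqmod /=; ring.
Qed.

Lemma qform_diag n (d : 'rV[R]_n) x :
  qform (diag_mx (map_mx (real_complex R) d)) x = \sum_i d 0 i * sqmod (x i 0).
Proof.
rewrite /qform mul_mx_diag mxE.
rewrite (_ : \sum_j _ = (\sum_i d 0 i * sqmod (x i 0))%:C) //.
rewrite rmorph_sum; apply: eq_bigr => i _; rewrite !mxE rmorphM /= -sqmodE.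
by rewrite -mulrA [in RHS]mulrCA.
Qed.

Lemma qform1 n (x : 'cV[C]_n) : qform 1%:M x = sqnorm x.
Proof.
rewrite (_ : 1%:M = diag_mx (map_mx (real_complex R) (const_mx 1))).
  by rewrite qform_diag; apply: eq_bigr => i _; rewrite mxE mul1r.
by rewrite map_const_mx diag_const_mx.
Qed.

Lemma qformD n (M N : 'M[C]_n) x : qform (M + N) x = qform M x + qform N x.
Proof. by rewrite /qform mulmxDr mulmxDl mxE raddfD. Qed.

Lemma qformB n (M N : 'M[C]_n) x : qform (M - N) x = qform M x - qform N x.
Proof. by rewrite /qform mulmxBr mulmxBl !mxE raddfB. Qed.

Lemma qform_conj m n (M : 'M[C]_m) (Z : 'M[C]_(n, m)) x :
  qform (Z *m M *m Z^H) x = qform M (Z^H *m x).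
Proof. by rewrite /qform adjmxM adjmxK !mulmxA. Qed.

Lemma qform_gram m n (Z : 'M[C]_(m, n)) x :
  qform (Z^H *m Z) x = sqnorm (Z *m x).
Proof. by have := qform_conj 1%:M Z^H x; rewrite mulmx1 adjmxK qform1. Qed.

(** The order on [R[i]] also asks that the form be real. This follows from [M^H = M], which makes
    the 1x1 matrix [x^H *m M *m x] its own adjoint. *)
Lemma psdmxP n (M : 'M[C]_n) :
  psdmx M <-> M^H = M /\ forall x, 0 <= qform M x.
Proof.
split=> [[/hermsymmxE Mh M0]|[Mh M0]].
  by split=> // x; have := M0 x; rewrite lecE => /andP[].
split=> [|x].
  by apply/is_hermitianmxP; rewrite expr0 scale1r; exact: esym Mh.
have xMx : (x^H *m M *m x)^H = x^H *m M *m x.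
  by rewrite !adjmxM adjmxK Mh mulmxA.
move/matrixP/(_ 0 0): xMx (M0 x); rewrite /qform -/(x^H) !mxE.
case: (\sum_j _) => u v [] /= /eqP; rewrite lecE /= => vN ->; rewrite andbT.
by move: vN; rewrite eq_sym -subr_eq0 opprK -mulr2n mulrn_eq0.
Qed.

(** * Unitary diagonalization with real eigenvalues *)

(** The columns of [Q^H] are eigenvectors and [Q *m x] lists the coordinates of [x] in that basis.
    Any unitary [Q] is allowed, not just the one chosen by [spectralmx]. *)
Definition spec n (Q : 'M[C]_n) (d : 'rV[R]_n) : 'M[C]_n :=
  Q^H *m diag_mx (map_mx (real_complex R) d) *m Q.

Lemma qform_spec n (Q : 'M[C]_n) d x :
  qform (spec Q d) x = \sum_i d 0 i * sqmod ((Q *m x) i 0).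
Proof. by rewrite /spec -{2}[Q]adjmxK qform_conj adjmxK qform_diag. Qed.

Lemma spec_adjmx n (Q : 'M[C]_n) d : (spec Q d)^H = spec Q d.
Proof.
rewrite /spec !adjmxM adjmxK mulmxA; congr (_ *m _ *m _).
rewrite /adjmx tr_diag_mx map_diag_mx; congr diag_mx.
by apply/rowP => i; rewrite !mxE; exact: conjc_real.
Qed.

Lemma spec_mulmx n (Q : 'M[C]_n) a b : Q \is unitarymx ->
  spec Q a *m spec Q b = spec Q (\row_i (a 0 i * b 0 i)).
Proof.
move=> Qu; rewrite /spec -!mulmxA (mulmxA Q) unitary_mulmxV // mul1mx.
rewrite (mulmxA (diag_mx _)) mulmx_diag; congr (_ *m (diag_mx _ *m _)).
by apply/rowP => i; rewrite !mxE rmorphM.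
Qed.

Lemma specD n (Q : 'M[C]_n) a b : spec Q a + spec Q b = spec Q (a + b).
Proof. by rewrite /spec -mulmxDl -mulmxDr -linearD map_mxD. Qed.

Lemma spec_const1 n (Q : 'M[C]_n) : Q \is unitarymx ->
  spec Q (const_mx 1) = 1%:M.
Proof.
by move=> Qu; rewrite /spec map_const_mx diag_const_mx mulmx1 unitary_mulVmx.
Qed.

Lemma spectral_decomposition n (H : 'M[C]_n) : H^H = H ->
  exists2 Q : 'M[C]_n, Q \is unitarymx & exists d, H = spec Q d.
Proof.
move=> Hh; have Hs : H \is hermsymmx.
  by apply/is_hermitianmxP; rewrite expr0 scale1r; exact: esym Hh.
have /orthomx_spectralP := hermitian_normalmx Hs.
have := spectral_unitarymx H; have := hermitian_spectral_diag_real Hs.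
move: (spectralmx H) (spectral_diag H) => P d /mxOverP dR Pu /= HE.
exists P => //; exists (map_mx (@complex.Re R) d).
rewrite [LHS]HE (invmx_unitary Pu) /spec.
congr (_ *m diag_mx _ *m _); apply/rowP => i; rewrite !mxE RRe_real //.
Qed.

Lemma sqnorm_unitary n (Q : 'M[C]_n) x : Q \is unitarymx ->
  sqnorm (Q *m x) = sqnorm x.
Proof. by move=> Qu; rewrite -qform_gram unitary_mulVmx // qform1. Qed.

Lemma spec_ge0 n (Q : 'M[C]_n) d : Q \is unitarymx ->
  (forall x, 0 <= qform (spec Q d) x) -> forall i, 0 <= d 0 i.
Proof.
(* The form is tested on the eigenvector for [d 0 i]. *)
move=> Qu d0 i; have := d0 (Q^H *m delta_mx i 0).
rewrite qform_spec mulmxA unitary_mulmxV // mul1mx.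
rewrite (bigD1 i) //= big1 => [|j ji].
  by rewrite !mxE !eqxx addr0 /sqmod /= expr1n expr0n addr0 mulr1.
by rewrite !mxE (negPf ji) sqmod0 mulr0.
Qed.

Lemma mxtrace_spec n (Q : 'M[C]_n) d : Q \is unitarymx ->
  \tr (spec Q d) = (\sum_i d 0 i)%:C.
Proof.
move=> Qu; rewrite mxtrace_mulC mulmxA unitary_mulmxV // mul1mx mxtrace_diag.
by rewrite rmorph_sum; apply: eq_bigr => i _; rewrite mxE.
Qed.

(** The unitary [P^H *m S *m Q] carries one eigenbasis to the other, permuted by [s]. It turns a
    matching of eigenvalues into a unitary similarity. *)
Lemma spec_perm n (P Q : 'M[C]_n) b (s : 'S_n) :
  P \is unitarymx -> Q \is unitarymx ->
  exists2 U : 'M[C]_n, U \is unitarymx &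
    U *m spec Q b *m U^H = spec P (\row_i b 0 (s i)).
Proof.
move=> Pu Qu; pose S : 'M[C]_n := perm_mx s.
have SV : S^H = perm_mx s^-1 by rewrite /adjmx tr_perm_mx map_perm_mx.
have Su : S \is unitarymx.
  by apply/unitarymxP; rewrite -/(S^H) SV -perm_mxM mulgV perm_mx1.
exists (P^H *m S *m Q);
  first exact: mul_unitarymx (mul_unitarymx (adjmx_unitary Pu) Su) Qu.
rewrite !adjmxM adjmxK /spec -!mulmxA; congr (_ *m _).
rewrite !(mulmxA Q) unitary_mulmxV // !mul1mx; rewrite !mulmxA; congr (_ *m _).
rewrite SV -row_permE -col_permE; apply/matrixP => i j.
by rewrite !mxE (inj_eq perm_inj).
Qed.

(** * Comparison of spectra *)

(** A dimension count in the style of Courant and Fischer. If more entries of [a] than of [b] reach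
    [c], the conditions on [x] number fewer than [n], so a unit vector satisfies them all. *)
Lemma perm_of_zeros n (K L : 'M[C]_n) (a b : 'rV[R]_n) :
  (forall (c : R) x, sqnorm x = 1 -> (exists i, b 0 i < c) ->
    (forall i, a 0 i < c -> (K *m x) i 0 = 0) ->
    (forall i, c <= b 0 i -> (L *m x) i 0 = 0) -> False) ->
  exists s : 'S_n, forall i, a 0 i <= b 0 (s i).
Proof.
move=> abF; apply: (@perm_of_count _ _ (a 0) (b 0)) => c.
rewrite leqNgt; apply/negP => ba.
have [|x x0 [xa xb]] := @mulmx_nontrivial_zeros _ n K L
    [pred i | a 0 i < c] [pred i | c <= b 0 i].
  rewrite -[X in (_ < X)%N](card_ord n) -(cardC [pred i | a 0 i < c]).
  rewrite ltn_add2l (leq_trans ba) // subset_leq_card //.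
  by apply/fintype.subsetP => i; rewrite !inE -leNgt.
have N0 : 0 < sqnorm x by rewrite lt_neqAle eq_sym sqnorm_eq0 x0 sqnorm_ge0.
apply: (abF c ((Num.sqrt (sqnorm x))^-1%:C *: x)) => [||i ac|i cb].
- by rewrite sqnormZ exprVn sqr_sqrtr ?ltW // mulVf ?gt_eqF.
- apply/existsP; apply: contraLR ba; rewrite negb_exists => /forallP cb.
  rewrite -leqNgt; apply: leq_trans (max_card _) _; apply: subset_leq_card.
  by apply/fintype.subsetP => i _; rewrite inE leNgt cb.
- by rewrite -scalemxAr mxE xa ?mulr0.
- by rewrite -scalemxAr mxE xb ?mulr0.
Qed.

(* If [P] diagonalizes [T^H *m T] then [T] maps the span of its eigenvectors with
   eigenvalue at least [c > 0] injectively to a space on which the form of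
   [T *m T^H] is at least [c]; equality of the traces makes the resulting
   inequality between the spectra an equality. *)
Lemma gram_similar n (T : 'M[C]_n) :
  exists2 U : 'M[C]_n, U \is unitarymx & T^H *m T = U *m (T *m T^H) *m U^H.
Proof.
have [P Pu [a Ta]] : exists2 P : 'M[C]_n, P \is unitarymx &
    exists d, T^H *m T = spec P d.
  by apply: spectral_decomposition; rewrite adjmxM adjmxK.
have [Q Qu [b Tb]] : exists2 P : 'M[C]_n, P \is unitarymx &
    exists d, T *m T^H = spec P d.
  by apply: spectral_decomposition; rewrite adjmxM adjmxK.
have a0 : forall i, 0 <= a 0 i.
  by apply: spec_ge0 Pu _ => x; rewrite -Ta qform_gram sqnorm_ge0.
have b0 : forall i, 0 <= b 0 i.
  apply: spec_ge0 Qu _ => x.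
  by rewrite -Tb -{1}[T]adjmxK qform_gram sqnorm_ge0.
have [s abs] : exists s : 'S_n, forall i, a 0 i <= b 0 (s i).
  (* Here [x] lies in the span of the eigenvectors of [T^H *m T] with eigenvalue at least [c], while
     [T *m x] has no component along those of [T *m T^H]. *)
  apply: (@perm_of_zeros n P (Q *m T)) => c x x1 [j bj] xa xb.
    have c0 : 0 < c by exact: le_lt_trans bj.
  (* The case [k = 0] bounds the square norm of [T *m x] below by [c]; the case [k = 1] bounds that
     of [T^H *m T *m x] below by [c] times that of [T *m x]. *)
  have aE k : (\sum_i c * (a 0 i ^+ k * sqmod ((P *m x) i 0)) <=
      \sum_i a 0 i ^+ k.+1 * sqmod ((P *m x) i 0)).
    apply: ler_sum => i _; rewrite mulrA.
    have [ac|ca] := ltP (a 0 i) c; first by rewrite xa // sqmod0 !mulr0.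
    by rewrite ler_wpM2r ?sqmod_ge0 // exprS ler_wpM2r // exprn_ge0.
  have Px : \sum_i sqmod ((P *m x) i 0) = 1.
    by rewrite -/(sqnorm _) sqnorm_unitary.
  have y2 : \sum_i a 0 i * sqmod ((P *m x) i 0) = sqnorm (T *m x).
    by rewrite -qform_gram Ta qform_spec.
  have y0 : 0 < sqnorm (T *m x).
    rewrite -y2; apply: lt_le_trans c0 _; have := aE 0%N; rewrite -mulr_sumr.
    by under eq_bigr do rewrite expr0 mul1r; rewrite Px mulr1.
  (* The terms of this sum are also nonnegative, so all vanish; together with [xb] this makes every
     coordinate of [T *m x] zero, against [y0]. *)
  have : \sum_i (c - b 0 i) * sqmod ((Q *m (T *m x)) i 0) <= 0.
    under eq_bigr do rewrite mulrBl.
    rewrite sumrB -mulr_sumr -/(sqnorm _) sqnorm_unitary // -qform_spec -Tb.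
    have := qform_conj (T *m T^H) T^H x; rewrite adjmxK => <-.
    rewrite [T^H *m _]mulmxA -mulmxA Ta spec_mulmx // qform_spec.
    have := aE 1%N; rewrite -mulr_sumr subr_le0 -y2.
    under [X in _ * X]eq_bigr do rewrite expr1.
    under [X in _ <= X]eq_bigr do rewrite expr2.
    by under [X in _ -> _ <= X]eq_bigr do rewrite mxE.
  have cb0 i : 0 <= (c - b 0 i) * sqmod ((Q *m (T *m x)) i 0).
    have [cb|bc] := leP c (b 0 i); last first.
      by rewrite mulr_ge0 ?sqmod_ge0 ?subr_ge0 ?ltW.
    by rewrite mulmxA xb // sqmod0 mulr0.
  rewrite le_eqVlt ltNge sumr_ge0 // orbF psumr_eq0 // => /allP y1.
  move: y0; rewrite -(sqnorm_unitary _ Qu) /sqnorm big1 ?ltxx // => i _.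
  have := y1 i (mem_index_enum _).
  rewrite mulf_eq0 subr_eq0 => /orP[/eqP ci|/eqP//].
  by rewrite mulmxA xb ?ci // sqmod0.
have [U Uu UE] := spec_perm b s Pu Qu.
exists U; first exact: Uu.
rewrite Tb UE Ta; congr (spec _ _); apply/rowP => i; rewrite mxE.
have : \sum_i (b 0 (s i) - a 0 i) == 0.
  rewrite sumrB -(reindex_inj (@perm_inj _ s) (P := xpredT) (F := b 0)) /=.
  rewrite subr_eq0 -(inj_eq (@complexI R)) -(mxtrace_spec a Pu).
  rewrite -(mxtrace_spec b Qu) -Ta -Tb.
  by rewrite mxtrace_mulC.
rewrite psumr_eq0 => [|j _]; last by rewrite subr_ge0.
by move=> /allP/(_ i (mem_index_enum _)); rewrite subr_eq0 => /eqP.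
Qed.

(** * Functional calculus *)

Lemma mxfun_spec n f (Q : 'M[C]_n) d : Q \is unitarymx ->
  mxfun f (spec Q d) = spec Q (map_mx f d).
Proof.
move=> Qu; rewrite /spec (mxfunE f d Qu).
by congr (_ *m diag_mx _ *m _); apply/rowP => i; rewrite !mxE.
Qed.

(* Both are matrix products, which the product lemmas would otherwise unfold. *)
Local Opaque spec mxfun.

Lemma mxfun_adjmx n f (H : 'M[C]_n) : H^H = H -> (mxfun f H)^H = mxfun f H.
Proof.
by case/spectral_decomposition => Q Qu [d ->]; rewrite (mxfun_spec _ _ Qu) spec_adjmx.
Qed.

Lemma mxfun_mulmx n f g (H : 'M[C]_n) : H^H = H ->
  mxfun f H *m mxfun g H = mxfun (fun x => f x * g x) H.
Proof.
case/spectral_decomposition => Q Qu [d ->]; rewrite !(mxfun_spec _ _ Qu) spec_mulmx //.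
by congr (spec Q _); apply/rowP => i; rewrite !mxE.
Qed.

Lemma qform_mxfun_le n f g (H : 'M[C]_n) x : psdmx H ->
  (forall t, 0 <= t -> f t <= g t) ->
  qform (mxfun f H) x <= qform (mxfun g H) x.
Proof.
move=> /psdmxP[/spectral_decomposition[Q Qu [d ->]] d0] fg.
rewrite !(mxfun_spec _ _ Qu) !qform_spec; apply: ler_sum => i _.
by rewrite !mxE ler_wpM2r ?sqmod_ge0 // fg // (spec_ge0 Qu d0).
Qed.

Lemma eq_mxfun n f g (H : 'M[C]_n) : psdmx H ->
  (forall t, 0 <= t -> f t = g t) -> mxfun f H = mxfun g H.
Proof.
move=> /psdmxP[/spectral_decomposition[Q Qu [d ->]] d0] fg.
rewrite !(mxfun_spec _ _ Qu); congr (spec Q _); apply/rowP => i.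
by rewrite !mxE fg // (spec_ge0 Qu d0).
Qed.

Lemma mxfun_id n (H : 'M[C]_n) : H^H = H -> mxfun id H = H.
Proof.
by case/spectral_decomposition => Q Qu [d ->]; rewrite (mxfun_spec _ _ Qu) map_mx_id.
Qed.

(** Constants act as multiples of the identity. The choice [c = 0] evaluates constant functions,
    [e = 0] extracts a factor, and [c = 1] handles the shift by [f 0]. *)
Lemma qform_mxfun_affine n f (c e : R) (H : 'M[C]_n) x : H^H = H ->
  qform (mxfun (fun t => c * f t + e) H) x =
    c * qform (mxfun f H) x + e * sqnorm x.
Proof.
case/spectral_decomposition => Q Qu [d ->]; rewrite !(mxfun_spec _ _ Qu) !qform_spec.
rewrite -(sqnorm_unitary x Qu) /sqnorm !mulr_sumr -big_split.
by apply: eq_bigr => i _; rewrite !mxE /= mulrDl mulrA.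
Qed.

Lemma psdmxD n (A B : 'M[C]_n) : psdmx A -> psdmx B -> psdmx (A + B).
Proof.
move=> /psdmxP[Ah A0] /psdmxP[Bh B0]; apply/psdmxP.
by split=> [|x]; rewrite ?adjmxD ?Ah ?Bh // qformD addr_ge0.
Qed.

Lemma conj_adjmx m n (H : 'M[C]_m) (Z : 'M[C]_(n, m)) :
  H^H = H -> (Z *m H *m Z^H)^H = Z *m H *m Z^H.
Proof. by move=> Hh; rewrite !adjmxM adjmxK Hh mulmxA. Qed.

Lemma conj_psdmx m n (H : 'M[C]_m) (Z : 'M[C]_(n, m)) :
  psdmx H -> psdmx (Z *m H *m Z^H).
Proof.
move=> /psdmxP[Hh H0]; apply/psdmxP.
by split=> [|x]; rewrite ?qform_conj ?conj_adjmx.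
Qed.

(** * Jensen's inequality for a contraction *)

(** Were an eigenvalue count to fail at [c], some unit [x] would give the left form a value at least
    [c] while having only components with [f (s 0 j) < c]. Jensen's inequality bounds that value by
    [f] of an average of the [s 0 j], which monotonicity bounds by some such [f (s 0 j)]. *)
Lemma mxfun_compress_le n f (H Z : 'M[C]_n) :
  monotone_function `[0, +oo[ f -> concave_function `[0, +oo[%classic f ->
  0 <= f 0 -> psdmx H -> (forall x, sqnorm (Z^H *m x) <= sqnorm x) ->
  exists2 U : 'M[C]_n, U \is unitarymx & forall x,
    qform (Z *m mxfun f H *m Z^H) x <=
    qform (U *m mxfun f (Z *m H *m Z^H) *m U^H) x.
Proof.
move=> fm fc f0 Hp Z1.
have [Sh S0] := (psdmxP _).1 (conj_psdmx Z Hp).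
have [P Pu [s SE]] := spectral_decomposition Sh; rewrite SE in S0.
have s0 := spec_ge0 Pu S0.
move: (Hp) => /psdmxP[/spectral_decomposition[Q Qu [h HE]] H0].
rewrite HE in H0; have h0 := spec_ge0 Qu H0.
have [L Lu [m ME]] : exists2 L : 'M[C]_n, L \is unitarymx &
    exists m, Z *m mxfun f H *m Z^H = spec L m.
  apply/spectral_decomposition/conj_adjmx/mxfun_adjmx.
  by case/psdmxP: Hp.
have [p mp] : exists p : 'S_n, forall i, m 0 i <= map_mx f s 0 (p i).
  apply: (@perm_of_zeros _ L P m (map_mx f s)) => c x x1 _ xm xs.
  (* These weights sum to at most 1, and not always to 1, because [Z^H] is only a contraction. *)
  pose w i := sqmod ((Q *m (Z^H *m x)) i 0).
  have w0 i : 0 <= w i by exact: sqmod_ge0.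
  have w1 : \sum_i w i <= 1.
    by rewrite -/(sqnorm _) sqnorm_unitary // -x1.
  have Px1 : \sum_j sqmod ((P *m x) j 0) = 1.
    by rewrite -/(sqnorm _) sqnorm_unitary.
  (* The index [j] has a nonzero coordinate, so [xs] excludes [c <= f (s 0 j)]. *)
  have [j] := monotone_average_le fm (fun j => sqmod_ge0 ((P *m x) j 0)) s0 Px1.
  rewrite sqmod_eq0 => Pxj; apply/negP; rewrite -ltNge.
  have fsc : f (s 0 j) < c.
    by rewrite ltNge; apply: contra Pxj => cs; rewrite xs ?mxE.
  apply: lt_le_trans fsc _.
  apply: (@le_trans _ _ (qform (Z *m mxfun f H *m Z^H) x)).
    rewrite ME qform_spec -[c]mulr1 -x1 -(sqnorm_unitary x Lu) mulr_sumr.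
    apply: ler_sum => i _.
    have [mc|cm] := ltP (m 0 i) c; first by rewrite xm // sqmod0 !mulr0.
    by rewrite ler_wpM2r ?sqmod_ge0.
  rewrite qform_conj HE (mxfun_spec _ _ Qu) qform_spec.
  under eq_bigr do rewrite mxE mulrC.
  apply: le_trans (subprobability_jensen fc f0 w0 h0 w1) _.
  rewrite le_eqVlt; apply/orP; left; apply/eqP; congr f.
  transitivity (qform (Z *m H *m Z^H) x); last first.
    by rewrite SE qform_spec; apply: eq_bigr => i _; rewrite mulrC.
  by rewrite qform_conj HE qform_spec; apply: eq_bigr => i _; rewrite mulrC.
have [U Uu UE] := spec_perm (map_mx f s) p Lu Pu.
exists U; first exact: Uu.
move=> x; rewrite ME SE (mxfun_spec _ _ Pu) UE !qform_spec.
by apply: ler_sum => i _; rewrite ler_wpM2r ?sqmod_ge0 // mxE.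
Qed.

Lemma mulmx_eq0P m n (M : 'M[C]_(m, n)) :
  (forall x : 'cV[C]_n, M *m x = 0) -> M = 0.
Proof.
move=> M0; apply/matrixP => i j; have /matrixP/(_ i 0) := M0 (delta_mx j 0).
by rewrite -colE !mxE.
Qed.

(** * Compression to the range of a dominating matrix *)

Section RangeCompression.
Variables (n : nat) (A H : 'M[C]_n).
Hypotheses (Ap : psdmx A) (Hp : psdmx H).
Hypothesis AH : forall x, qform A x <= qform H x.

Let Ah : A^H = A. Proof. by case/psdmxP: Ap. Qed.
Let Hh : H^H = H. Proof. by case/psdmxP: Hp. Qed.

Let rA := mxfun Num.sqrt A.
(* [(Num.sqrt 0)^-1 = 0], so [K] is the pseudo-inverse of the root of [H]. *)
Let K := mxfun (fun t : R => (Num.sqrt t)^-1) H.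
(** [mxfun p H] is the orthogonal projection onto the range of [H]. *)
Let p (t : R) : R := (t != 0)%:R.

Let rAh : rA^H = rA. Proof. exact: mxfun_adjmx. Qed.
Let Kh : K^H = K. Proof. exact: mxfun_adjmx. Qed.

Let rA2 : rA *m rA = A.
Proof.
rewrite (mxfun_mulmx _ _ Ah) -[RHS](mxfun_id Ah); apply: (eq_mxfun Ap) => t t0.
by rewrite -expr2 sqr_sqrtr.
Qed.

Lemma mxfun_range_proj : K *m H *m K = mxfun p H.
Proof.
rewrite -[X in _ *m X *m _](mxfun_id Hh) !(mxfun_mulmx _ _ Hh).
apply: (eq_mxfun Hp) => t t0; rewrite /p; have [->|tn0] := eqVneq t 0.
  by rewrite mulr0 mul0r.
by rewrite mulrAC -invfM -expr2 sqr_sqrtr // mulVf.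
Qed.

(** Since the form of [A] lies between 0 and that of [H], the kernel of [H] is contained in that of
    [rA]; [N] is the projection onto the kernel of [H]. *)
Lemma sqrt_mul_range_proj : rA *m mxfun p H = rA.
Proof.
pose N := mxfun (fun t => 1 - p t) H.
have rAN : rA *m N = 0.
  apply: mulmx_eq0P => x; apply/eqP.
  rewrite -mulmxA -sqnorm_eq0 -qform_gram rAh rA2.
  rewrite eq_le ((psdmxP _).1 Ap).2 andbT.
  apply: le_trans (AH _) _.
  have Nh : N^H = N by exact: mxfun_adjmx.
  have := qform_conj H N^H x; rewrite adjmxK => <-.
  rewrite Nh -[X in _ *m X *m _](mxfun_id Hh) !(mxfun_mulmx _ _ Hh).
  rewrite [X in qform X](@eq_mxfun _ _ (fun t => 0 * t + 0)) //.
    by rewrite qform_mxfun_affine // !mul0r addr0.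
  move=> t _; rewrite /p; have [->|_] := eqVneq t 0.
    by rewrite !(mulr0, mul0r, addr0).
  by rewrite subrr !mul0r addr0.
have NP : N + mxfun p H = 1%:M.
  rewrite /N; case/spectral_decomposition: Hh => Q Qu [d ->].
  rewrite !(mxfun_spec _ _ Qu) specD (_ : _ + _ = const_mx 1) ?spec_const1 //.
  by apply/rowP => i; rewrite !mxE subrK.
by rewrite -[RHS](mulmx1 rA) -NP mulmxDr rAN add0r.
Qed.

(** As [f] may be negative, it is split into a factor [c] and a square, so that a Gram matrix
    appears. *)
Lemma qform_range_compression_le (f g : R -> R) (c : R) :
  monotone_function `[0, +oo[ f -> concave_function `[0, +oo[%classic f ->
  0 <= f 0 -> (forall t, 0 <= t -> c * (g t * g t) = f t) ->
  exists2 U : 'M[C]_n, U \is unitarymx & forall x,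
   c * qform (mxfun g H *m (K *m A *m K) *m mxfun g H) x <=
   qform (U *m mxfun f A *m U^H) x.
Proof.
move=> fm fc f0 gf; pose X := rA *m K; pose G := mxfun g H.
have Gh : G^H = G by exact: mxfun_adjmx.
have GG : G *m G = mxfun (fun t => g t * g t) H by exact: mxfun_mulmx Hh.
have XX : X^H *m X = K *m A *m K.
  by rewrite adjmxM Kh rAh mulmxA -(mulmxA K rA rA) rA2.
have XHX : X *m H *m X^H = A.
  rewrite adjmxM Kh rAh -(mulmxA rA K H) mulmxA -(mulmxA rA (K *m H) K).
  by rewrite mxfun_range_proj sqrt_mul_range_proj.
(* By [gram_similar], [X *m X^H] is unitarily similar to [X^H *m X = K *m A *m K], which is at most
   the projection [K *m H *m K]. *)
have X1 x : sqnorm (X^H *m x) <= sqnorm x.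
  have [U Uu UE] := gram_similar X^H.
  rewrite -qform_gram UE adjmxK XX qform_conj.
  rewrite -[in leRHS](sqnorm_unitary x (adjmx_unitary Uu)).
  move: (U^H *m x) => y; rewrite -{2}Kh qform_conj; apply: le_trans (AH _) _.
  rewrite -qform_conj Kh mxfun_range_proj.
  apply: le_trans (@qform_mxfun_le _ _ (fun t => 0 * t + 1) _ _ Hp _) _.
    by move=> t _; rewrite mul0r add0r /p lern1 leq_b1.
  by rewrite qform_mxfun_affine // mul0r add0r mul1r.
rewrite -/G; clearbody X G.
have [U Uu UE] := mxfun_compress_le fm fc f0 Hp X1.
have [W Wu WE] := gram_similar (X *m G).
(* [W] exchanges the two Gram matrices of [X *m G], and [U] comes from the Jensen bound for [X]. *)
exists (W *m U); first exact: mul_unitarymx Wu Uu.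
move=> x.
have -> : qform (W *m U *m mxfun f A *m (W *m U)^H) x =
    qform (U *m mxfun f A *m U^H) (W^H *m x).
  by move: (mxfun f A) => M; rewrite -qform_conj [(W *m U)^H]adjmxM !mulmxA.
have -> : G *m (K *m A *m K) *m G = (X *m G)^H *m (X *m G).
  by rewrite -XX -{1}Gh; rewrite adjmxM !mulmxA.
rewrite WE qform_conj; move: (W^H *m x) => y.
rewrite -XHX; apply: le_trans (UE y).
have -> : qform (X *m G *m (X *m G)^H) y = qform (G *m G) (X^H *m y).
  by rewrite -{4}Gh -qform_conj adjmxM !mulmxA.
rewrite GG [in leRHS]qform_conj.
have := qform_mxfun_affine (fun t => g t * g t) c 0 (X^H *m y) Hh.
rewrite mul0r addr0 => <-; apply: qform_mxfun_le => // t t0.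
by rewrite addr0 gf.
Qed.

End RangeCompression.

(** * Subadditivity up to unitaries *)

Lemma mxfun_subadd0 n (f : R -> R) (A B : 'M[C]_n) :
  monotone_function `[0, +oo[ f -> concave_function `[0, +oo[%classic f ->
  f 0 = 0 -> psdmx A -> psdmx B ->
  exists U V : 'M[C]_n, [/\ U \is unitarymx, V \is unitarymx & forall x,
    qform (mxfun f (A + B)) x <=
    qform (U *m mxfun f A *m U^H) x + qform (V *m mxfun f B *m V^H) x].
Proof.
move=> fm fc f0 Ap Bp.
have [[_ A0] [_ B0]] := ((psdmxP _).1 Ap, (psdmxP _).1 Bp).
have Hp := psdmxD Ap Bp.
have AH x : qform A x <= qform (A + B) x by rewrite qformD lerDl.
have BH x : qform B x <= qform (A + B) x by rewrite qformD lerDr.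
have [Hh _] := (psdmxP _).1 Hp.
pose g t := Num.sqrt `|f t|.
(* Monotonicity and [f 0 = 0] give [f] a constant sign, which is [c]. *)
have [c fg] : exists c, forall t, 0 <= t -> c * (g t * g t) = f t.
  have in0 (t : R) : 0 <= t -> t \in `[0, +oo[ by rewrite in_itv /= andbT.
  case: fm => fm; [exists 1|exists (-1)] => t t0; rewrite -expr2 sqr_sqrtr //.
    by rewrite mul1r ger0_norm // -f0 fm ?in0.
  by rewrite mulN1r ler0_norm ?opprK // -f0 fm ?in0.
have f00 : 0 <= f 0 by rewrite f0.
have [U Uu UE] := qform_range_compression_le Ap Hp AH fm fc f00 fg.
have [V Vu VE] := qform_range_compression_le Bp Hp BH fm fc f00 fg.
exists U, V; split=> // x; apply: le_trans (lerD (UE x) (VE x)).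
(* The two compressed terms add up to [K *m (A + B) *m K], the range projection, between two factors
   [mxfun g (A + B)]. *)
rewrite -mulrDr -qformD -mulmxDl -mulmxDr -mulmxDl -mulmxDr.
rewrite mxfun_range_proj // !(mxfun_mulmx _ _ Hh).
have := qform_mxfun_affine (fun t => g t * (t != 0)%:R * g t) c 0 x Hh.
rewrite mul0r addr0 => <-; apply: qform_mxfun_le => // t t0; rewrite addr0.
(* The projection discards only the eigenvalue 0, where [f] vanishes. *)
by have [->|_] := eqVneq t 0; [rewrite f0 mulr0 mul0r mulr0|rewrite mulr1 fg].
Qed.

End Forms.

Theorem theorem2p1 (R : realType) (n : nat) (f : R -> R) (A B : 'M[R[i]]_n)
    (f_mono : monotone_function `[0, +oo[ f)
    (f_concave : concave_function `[0, +oo[%classic f)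
    (f0 : 0 <= f 0)
    (A_psd : psdmx A) (B_psd : psdmx B) :
  exists U V : 'M[R[i]]_n,
    [/\ U \is unitarymx, V \is unitarymx &
        loewner_le (mxfun f (A + B))
          (U *m mxfun f A *m U^t* + V *m mxfun f B *m V^t*)].
Proof.
pose h t := f t - f 0.
have h_mono : monotone_function `[0, +oo[ h.
  by case: f_mono => fm; [left|right] => x y x0 y0 xy; rewrite lerD2r fm.
have h_concave : concave_function `[0, +oo[%classic h.
  move=> t x y x0 y0; have := f_concave t x y x0 y0.
  by rewrite !convRE /h /unstable.onem; lra.
have h0 : h 0 = 0 by rewrite /h subrr.
have [U [V [Uu Vu UV]]] := mxfun_subadd0 h_mono h_concave h0 A_psd B_psd.
exists U, V; split; [exact: Uu|exact: Vu|apply/psdmxP].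
have [[Ah _] [Bh _]] := ((psdmxP _).1 A_psd, (psdmxP _).1 B_psd).
have AB_psd := psdmxD A_psd B_psd.
have [ABh _] := (psdmxP _).1 AB_psd.
have fE (H : 'M_n) x : psdmx H ->
    qform (mxfun f H) x = qform (mxfun h H) x + f 0 * sqnorm x.
  move=> Hp; have [Hh _] := (psdmxP _).1 Hp.
  have -> : mxfun f H = mxfun (fun t => 1 * h t + f 0) H.
    by apply: (eq_mxfun Hp) => t _; rewrite /h mul1r subrK.
  by rewrite (qform_mxfun_affine h 1 (f 0) x Hh) mul1r.
split=> [|x].
  rewrite adjmxB adjmxD mxfun_adjmx // -/(adjmx U) -/(adjmx V).
  by rewrite !conj_adjmx ?mxfun_adjmx.
rewrite qformB qformD subr_ge0 fE // !qform_conj !fE //.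
rewrite !sqnorm_unitary ?adjmx_unitary //.
have := UV x; rewrite !qform_conj => UVx.
(* Undoing the shift adds [f 0 * sqnorm x] once on the left and twice on the right. *)
have : 0 <= f 0 * sqnorm x by rewrite mulr_ge0 ?sqnorm_ge0.
lra.
Qed.
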